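(* Let $1 \leq p < \infty$ and let $t, s \in \mathbb{R}$. Then the following are equivalent: (A) for every measurable function $f$ on $\mathbb{R}$, the two conditions $f(t + x) - f(x) \in L^p(\mathbb{R})$ and $(\sin sx)\cdot f(x) \in L^p(\mathbb{R})$ (as functions of $x$) imply $f \in L^p(\mathbb{R})$; (B) $ts \notin \pi\mathbb{Z}$.
   Context: Measurability and $L^p(\mathbb{R})$ are with respect to Lebesgue measure on $\mathbb{R}$. Here $\pi\mathbb{Z} = \{\pi k : k \in \mathbb{Z}\}$, which includes $0$. *)

(* Defs.v *)
From HB Require Import structures.
From mathcomp Require Import all_boot all_order all_algebra.
From mathcomp Require Import complex.
From mathcomp Require Import all_classical all_reals all_analysis.

Set Implicit Arguments.
Unset Strict Implicit.
Unset Printing Implicit Defensive.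

Import Order.TTheory GRing.Theory Num.Theory.
Import numFieldNormedType.Exports.

Local Open Scope classical_set_scope.
Local Open Scope ring_scope.

(* The real line with the sigma-algebra of Lebesgue-measurable sets, i.e. the
   completion of the Borel one (completed_caratheodory_measurable). The
   underlying type is convertible to R, so that a function R -> R can be used
   as a function on lebesgue_line R; the codomain keeps its Borel sets. *)
Notation lebesgue_line R := (caratheodory_type ((wlength (@idfun R))^*)%mu).

Definition lebesgue_measurable (R : realType) (f : R -> R) : Prop :=
  measurable_fun [set: lebesgue_line R] (f : lebesgue_line R -> R).

Definition memLp (R : realType) (p : R) (f : R -> R) : Prop :=
  (f : lebesgue_line R -> R) \in Lfun (@completed_lebesgue_measure R) p%:E.

(* The library has no sigma-algebra on R[i]: measurability is stated
   componentwise, which is measurability for the Borel sets of R[i] = R^2. *)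
Definition lebesgue_measurableC (R : realType) (f : R -> R[i]) : Prop :=
  lebesgue_measurable (fun x => complex.Re (f x)) /\
  lebesgue_measurable (fun x => complex.Im (f x)).

(* The norm of R[i] takes values in R[i]; Normc.normc is the modulus as an
   element of R. *)
Definition memLpC (R : realType) (p : R) (f : R -> R[i]) : Prop :=
  lebesgue_measurableC f /\
  finite_norm (@completed_lebesgue_measure R) p%:E
    (fun x : lebesgue_line R => Normc.normc (f x)).

(* Main.v *)
Require Import Defs.
From mathcomp Require Import all_boot all_order all_algebra.
From mathcomp Require Import complex.
From mathcomp Require Import ring lra.
From mathcomp Require Import all_classical all_reals all_analysis.
From mathcomp Require Import measurable_realfun.

Set Implicit Arguments.
Unset Strict Implicit.
Unset Printing Implicit Defensive.

Import Order.TTheory GRing.Theory Num.Theory.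
Import numFieldNormedType.Exports.

Local Open Scope classical_set_scope.
Local Open Scope ring_scope.

(** Write h(x) = f(t + x) - f(x) and g(x) = sin(sx) f(x).

    If ts is not in pi Z, then sin(st) <> 0, and expanding
    sin(st) = sin(s(t + x) - sx) gives
    sin(st) f(x) = cos(sx) [g(t + x) - sin(s(t + x)) h(x)] - cos(s(t + x)) g(x).
    The right-hand side is a sum of products of a bounded continuous function
    with g, h or a translate of g, so it is in L^p as soon as g and h are
    ([memLp_of_sin_diff]). The only fact about Lebesgue measure used here is
    that it is invariant under translation ([memLp_translate]).

    If ts is in pi Z, there is a grid T Z, with T > 0, such that t is in T Z and
    sT is in pi Z ([common_grid]). Then sin(s.) vanishes on the grid, and f is
    taken to be the indicator of a comb whose j-th tooth starts at the grid
    point jT and has width T/(j+1), for j >= 0: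
    - f is not in L^p because the harmonic series diverges;
    - translating by T replaces each tooth by the next one, so the
      supports differ by sets whose lengths telescope, and f(T + .) - f is in
      L^p; hence so is f(t + .) - f, as t is a multiple of T;
    - on the j-th tooth |sin(sx)| <= |s| T/(j+1), so the integral of
      |sin(sx) f(x)| is at most a multiple of the sum of the 1/(j+1)^2. As
      |sin(sx) f(x)| <= 1 and p >= 1, its p-th power is integrable as well.

    A complex function is in L^p exactly when its two components are
    ([memLpC_components]); as t and sin(sx) are real, the complex equivalence
    reduces to the real one. *)

(** * Membership in L^p over a general measure space *)

Lemma measure_preserving_integral d (T : measurableType d) (R : realType)
    (mu : {measure set T -> \bar R}) (phi : T -> T) (f : T -> \bar R) :
  measurable_fun setT phi ->
  (forall A, measurable A -> mu (phi @^-1` A) = mu A) ->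
  measurable_fun setT f -> (forall x, 0 <= f x)%E ->
  (\int[mu]_x (f \o phi) x = \int[mu]_x f x)%E.
Proof.
move=> mphi phimu mf f0.
transitivity (\int[pushforward mu phi]_x f x)%E.
  by rewrite ge0_integral_pushforward.
by apply: eq_measure_integral => A mA _; exact: phimu.
Qed.

Lemma measurable_powR_norm d (T : measurableType d) (R : realType) (p : R)
    (f : T -> R) : measurable_fun setT f ->
  measurable_fun setT (fun x => (`|f x| `^ p)%:E).
Proof.
move=> mf; apply/measurable_EFinP.
apply: (measurableT_comp (measurable_powR _)) => //.
exact: measurableT_comp.
Qed.

Section Lfun_criteria.
Context d (T : measurableType d) (R : realType).
Variables (mu : {measure set T -> \bar R}) (p : R).
Hypothesis p1 : 1 <= p.

Lemma Lfun_integralP (f : T -> R) : f \in Lfun mu p%:E <->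
  measurable_fun setT f /\ (\int[mu]_x (`|f x| `^ p)%:E < +oo)%E.
Proof.
rewrite inE; split.
  move=> lf; split; first by move: lf => /andP[] /[!inE].
  have /integrableP[_] : mu.-integrable setT (fun x => (`|f x| `^ p)%:E).
    by apply: Lfun_integrable => //; rewrite inE.
  by under eq_integral => x _ do rewrite gee0_abs ?lee_fin ?powR_ge0//.
move=> [mf If]; apply/andP; rewrite !inE; split => //=.
by rewrite /finite_norm unlock; exact: poweR_lty.
Qed.

Lemma Lfun_dominated (f g : T -> R) :
  measurable_fun setT f -> (forall x, `|f x| <= `|g x|) ->
  g \in Lfun mu p%:E -> f \in Lfun mu p%:E.
Proof.
move=> mf fg /Lfun_integralP[mg gfin].
apply/Lfun_integralP; split; first exact: mf.
apply: le_lt_trans gfin; apply: ge0_le_integral.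
- exact: measurableT.
- by move=> x _; rewrite lee_fin powR_ge0.
- exact: measurable_powR_norm.
- exact: measurable_powR_norm.
- move=> x _; rewrite lee_fin ge0_ler_powR// ?nnegrE//.
  by rewrite (le_trans _ p1).
Qed.

(** Since |h| <= 1 and p >= 1, |h|^p <= |h|, and |h| is at most the sum of the
    c_j 1_(A_j); the bound on the partial sums says that this sum is
    integrable. *)
Lemma Lfun_of_cover (M : R) (h : T -> R) (c : nat -> R) (A : nat -> set T) :
  measurable_fun setT h -> (forall x, `|h x| <= 1) ->
  (forall j, 0 <= c j) -> (forall j, measurable (A j)) ->
  (forall x, h x != 0 -> exists2 j, A j x & `|h x| <= c j) ->
  (forall n, (\sum_(0 <= j < n) (c j)%:E * mu (A j) <= M%:E)%E) ->
  h \in Lfun mu p%:E.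
Proof.
move=> mh h1 c0 mA hA sumM.
apply/Lfun_integralP; split; first exact: mh.
pose g j x := ((c j)%:E * (\1_(A j) x)%:E)%E.
have g0 j x : (0 <= g j x)%E by rewrite mule_ge0// lee_fin.
have mg j : measurable_fun setT (g j).
  by apply: measurable_funeM; apply/measurable_EFinP; exact: measurable_indic.
apply: (@le_lt_trans _ _ M%:E); last exact: ltry.
apply: (@le_trans _ _ (\int[mu]_x (\sum_(j <oo) g j x))%E); last first.
  rewrite integral_nneseries//.
  apply: lime_le; first by apply: is_cvg_nneseries => n _ _; exact: integral_ge0.
  apply: nearW => n /=; apply: le_trans (sumM n).
  apply: lee_sum => j _.
  rewrite ge0_integralZl_EFin//; last first.
    by apply/measurable_EFinP; exact: measurable_indic.
  by rewrite integral_indic// setIT.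
apply: ge0_le_integral.
- exact: measurableT.
- by move=> x _; rewrite lee_fin powR_ge0.
- exact: measurable_powR_norm.
- by apply: ge0_emeasurable_sum => // k x _ _.
move=> x _; have [->|hx] := eqVneq (h x) 0.
  rewrite normr0 powR0; last by rewrite gt_eqF// (lt_le_trans _ p1).
  exact: nneseries_ge0.
have [j Ajx hc] := hA x hx.
apply: (@le_trans _ _ (g j x)).
  rewrite /g indicE mem_set//= mule1 lee_fin (le_trans _ hc)//.
  by apply: ge1r_powR => //; rewrite normr_gt0 hx h1.
apply: le_trans (@nneseries_lim_ge R (g^~ x) xpredT 0 j.+1 _) => //.
by rewrite big_nat_recr//= leeDr// sume_ge0.
Qed.

End Lfun_criteria.

(** * Translation invariance of Lebesgue measure *)

Section translation.
Variable R : realType.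
Local Notation mu := (@completed_lebesgue_measure R).
Local Notation lstar := ((wlength (@idfun R))^*)%mu.

Lemma outer_translate_le (c : R) (A : set R) :
  (lstar ((fun x => (c + x)%R) @^-1` A) <= lstar A)%E.
Proof.
apply: le_ereal_inf_tmp => _ [B [mB AB] <-].
apply: ereal_inf_lbound.
exists (fun i => (fun x => c + x) @^-1` B i).
  split; last by move=> x /AB [i _ Bi]; exists i.
  move=> i; have [[a b] _ /= <-] := mB i.
  exists (a - c, b - c) => //=.
  by apply/seteqP; split=> x /=; rewrite !in_itv/=; lra.
apply: eq_eseriesr => i _; have [[a b] _ /= <-] := mB i.
have -> : (fun x => c + x) @^-1` `]a, b]%classic = `]a - c, b - c]%classic.
  by apply/seteqP; split=> x /=; rewrite !in_itv/=; lra.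
rewrite !wlength_itv/= !lte_fin ltrD2r; case: ifP => // _.
by rewrite -!EFinD; congr EFin; lra.
Qed.

(** The outer measure is an infimum over countable covers by half-open
    intervals, and a translate of such a cover is again one, with the same
    lengths. This holds for every set, so that it also gives the
    invariance of Caratheodory measurability. *)
Lemma outer_translate (c : R) (A : set R) :
  lstar ((fun x => (c + x)%R) @^-1` A) = lstar A.
Proof.
apply/eqP; rewrite eq_le outer_translate_le /=.
apply: le_trans (outer_translate_le (- c) _).
apply: le_outer_measure => x Ax /=.
by rewrite addrA subrr add0r.
Qed.

Lemma measurable_translate (c : R) :
  measurable_fun [set: lebesgue_line R]
    (fun x : lebesgue_line R => c + x : lebesgue_line R).
Proof.
move=> _ A mA; rewrite setTI.
suff : caratheodory_measurable lstar ((fun x => c + x) @^-1` A) by [].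
have {}mA : caratheodory_measurable lstar A by [].
move=> X.
(* Any test set X is a translate of a set Y, for which A splits lstar. *)
pose tau := fun x : R => c + x; pose Y := (fun x => - c + x) @^-1` X.
have -> : X = tau @^-1` Y.
  by apply/seteqP; split=> x; rewrite /Y /tau /= addrA addNr add0r.
change (lstar (tau @^-1` Y) = lstar (tau @^-1` (Y `&` A)) +
  lstar (tau @^-1` (Y `&` ~` A)))%E.
rewrite !(outer_translate c).
exact: (mA Y).
Qed.

Lemma integral_translate (c : R) (f : R -> \bar R) :
  measurable_fun [set: lebesgue_line R] (f : lebesgue_line R -> \bar R) ->
  (forall x, 0 <= f x)%E ->
  (\int[mu]_x (f \o +%R c) x = \int[mu]_x f x)%E.
Proof.
move=> mf f0.
pose tau : lebesgue_line R -> lebesgue_line R := +%R c.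
have mtau : measurable_fun [set: lebesgue_line R] tau.
  exact: measurable_translate.
have mu_tau (A : set (lebesgue_line R)) :
    measurable A -> mu (tau @^-1` A) = mu A.
  by move=> _; exact: (outer_translate c A).
exact: (@measure_preserving_integral _ _ _ mu tau f).
Qed.

End translation.

(** * Measurable and L^p functions on the line *)

Section Lp_line.
Variable R : realType.
Local Notation LR := (lebesgue_line R).
Local Notation mu := (@completed_lebesgue_measure R).
Implicit Types f g b : R -> R.

Lemma borel_lebesgue_measurable f :
  measurable_fun [set: measurableTypeR R] (f : measurableTypeR R -> R) ->
  lebesgue_measurable f.
Proof. by move=> mf _ A mA; apply: sub_caratheodory; exact: mf. Qed.

Lemma continuous_lebesgue_measurable f : continuous f -> lebesgue_measurable f.
Proof.
by move=> cf; apply: borel_lebesgue_measurable; exact: continuous_measurable_fun.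
Qed.

Lemma lebesgue_measurableM f g : lebesgue_measurable f ->
  lebesgue_measurable g -> lebesgue_measurable (fun x => f x * g x).
Proof. by move=> mf mg; exact: (@measurable_funM _ LR). Qed.

Lemma lebesgue_measurableB f g : lebesgue_measurable f ->
  lebesgue_measurable g -> lebesgue_measurable (fun x => f x - g x).
Proof. by move=> mf mg; exact: (@measurable_funB _ LR). Qed.

Lemma lebesgue_measurable_translate (c : R) f :
  lebesgue_measurable f -> lebesgue_measurable (fun x => f (c + x)).
Proof.
move=> mf; exact: (@measurableT_comp _ _ _ LR LR _ f setT
  (+%R c : LR -> LR) mf (measurable_translate c)).
Qed.

Variable p : R.
Hypothesis p1 : 1 <= p.

Lemma memLp_measurable f : memLp p f -> lebesgue_measurable f.
Proof. by move=> /(@Lfun_integralP _ LR R mu p p1 f)[]. Qed.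

Lemma memLpD f g : memLp p f -> memLp p g -> memLp p (fun x => f x + g x).
Proof.
have [_ D] := @Lfun_addr_closed _ LR R mu p%:E p1.
by move=> lf lg; exact: (D _ _ lf lg).
Qed.

Lemma memLpN f : memLp p f -> memLp p (fun x => - f x).
Proof. by move=> lf; exact: (@Lfun_oppr_closed _ LR R mu p%:E _ lf). Qed.

Lemma memLpB f g : memLp p f -> memLp p g -> memLp p (fun x => f x - g x).
Proof. by move=> lf lg; apply: memLpD => //; exact: memLpN. Qed.

Lemma memLp0 : memLp p (fun=> 0).
Proof. by have [Z _] := @Lfun_addr_closed _ LR R mu p%:E p1. Qed.

Lemma memLp_dominated f g : lebesgue_measurable f ->
  (forall x, `|f x| <= `|g x|) -> memLp p g -> memLp p f.
Proof. by move=> mf fg; exact: (@Lfun_dominated _ LR R mu p p1 f g mf fg). Qed.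

Lemma memLp_translate (c : R) f : memLp p f -> memLp p (fun x => f (c + x)).
Proof.
move=> /(@Lfun_integralP _ LR R mu p p1 f)[mf If].
apply/(@Lfun_integralP _ LR R mu p p1); split.
  exact: lebesgue_measurable_translate.
rewrite -(integral_translate c) in If.
- exact: If.
- exact: (@measurable_powR_norm _ LR).
- by move=> x; rewrite lee_fin powR_ge0.
Qed.

Lemma memLp_bounded_mul (C : R) b f : lebesgue_measurable b ->
  (forall x, `|b x| <= C) -> memLp p f -> memLp p (fun x => b x * f x).
Proof.
move=> mb bC lf.
apply: (@memLp_dominated _ (fun x => f x * C)).
- by apply: lebesgue_measurableM => //; exact: memLp_measurable.
- move=> x; rewrite !normrM mulrC ler_wpM2l// (le_trans (bC x))//.
  exact: ler_norm.
- exact: (@Lfun_scale _ LR R mu f C p p1 lf).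
Qed.

(** Both directions are dominations: |Re z| and |Im z| are at most |z|, which
    is at most |Re z| + |Im z|. *)
Lemma memLpC_components (f : R -> R[i]) :
  memLpC p f <->
  memLp p (fun x => complex.Re (f x)) /\ memLp p (fun x => complex.Im (f x)).
Proof.
pose n x := Normc.normc (f x).
have Re_le x : `|complex.Re (f x)| <= `|n x|.
  rewrite /n; case: (f x) => a b /=.
  by rewrite (ger0_norm (sqrtr_ge0 _)) -sqrtr_sqr ler_wsqrtr// lerDl sqr_ge0.
have Im_le x : `|complex.Im (f x)| <= `|n x|.
  rewrite /n; case: (f x) => a b /=.
  by rewrite (ger0_norm (sqrtr_ge0 _)) -sqrtr_sqr ler_wsqrtr// lerDr sqr_ge0.
have n_le x : `|n x| <= `| `|complex.Re (f x)| + `|complex.Im (f x)| |.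
  rewrite /n; case: (f x) => a b /=.
  rewrite (ger0_norm (sqrtr_ge0 _)) [leRHS]ger0_norm; last exact: addr_ge0.
  rewrite -[leRHS]ger0_norm; last exact: addr_ge0.
  rewrite -sqrtr_sqr ler_wsqrtr// sqrrD !real_normK ?num_real// lerD2r.
  by rewrite lerDl mulrn_wge0// mulr_ge0.
have mn : lebesgue_measurableC f -> lebesgue_measurable n.
  move=> [mr mi].
  have m2 : lebesgue_measurable (fun x => complex.Re (f x) * complex.Re (f x) +
                                          complex.Im (f x) * complex.Im (f x)).
    by apply: (@measurable_funD _ LR); exact: lebesgue_measurableM.
  have msq : measurable_fun setT (@Num.sqrt R).
    by apply: continuous_measurable_fun; exact: sqrt_continuous.
  have -> : n = @Num.sqrt R \o
      (fun x => complex.Re (f x) * complex.Re (f x) +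
                complex.Im (f x) * complex.Im (f x)).
    by apply/funext => x; rewrite /n /=; case: (f x).
  exact: (@measurableT_comp _ _ _ LR _ _ _ setT _ msq m2).
split.
  move=> [mf fin]; have ln : memLp p n.
    rewrite /memLp inE; apply/andP; rewrite !inE.
    by split; [exact: mn mf|exact: fin].
  have [mr mi] := mf.
  by split; [exact: (memLp_dominated mr Re_le)|exact: (memLp_dominated mi Im_le)].
move=> [lr li]; have mf : lebesgue_measurableC f.
  by split; [exact: (memLp_measurable lr)|exact: (memLp_measurable li)].
split=> //.
have labs (u : R -> R) : memLp p u -> memLp p (fun x => `|u x|).
  move=> lu; apply: (memLp_dominated _ _ lu).
    exact: (@measurableT_comp _ _ _ LR _ _ _ setT _ (@normr_measurable R setT)
      (memLp_measurable lu)).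
  by move=> x; rewrite normr_id.
have := memLp_dominated (mn mf) n_le (memLpD (labs _ lr) (labs _ li)).
by rewrite /memLp inE => /andP[_]; rewrite inE.
Qed.

End Lp_line.

(** * Zeros and size of the sine *)

Lemma norm_sin_add_pi (R : realType) (y : R) (k : int) :
  `|sin (y + k%:~R * pi)| = `|sin y|.
Proof.
have nat_case (z : R) (n : nat) : `|sin (z + n%:R * pi)| = `|sin z|.
  by rewrite mulr_natl (alternatingn (@sinDpi R)) normrM normrX normrN1 expr1n
             mul1r.
case: k => n; first exact: nat_case.
by rewrite -[in RHS](subrK (n.+1%:R * pi) y) nat_case NegzE mulrNz mulNr.
Qed.

(** Subtracting a multiple of pi brings x into [0, pi[, and the sine is positive
    on ]0, pi[. *)
Lemma sin_eq0_pi (R : realType) (x : R) :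
  sin x = 0 -> exists k : int, x = pi * k%:~R.
Proof.
move=> sx; exists (Num.floor (x / pi)).
have pi0 := @pi_gt0 R.
have /andP[fl fu] := floor_itv (x / pi).
set k := Num.floor _ in fl fu *.
move: fl fu; rewrite ler_pdivlMr// ltr_pdivrMr// intrD => fl fu.
have sy : sin (x - k%:~R * pi) = 0.
  by apply/eqP; rewrite -normr_eq0 -(norm_sin_add_pi _ k) subrK sx normr0.
have [|y_ne0] := eqVneq (x - k%:~R * pi) 0.
  by move=> /eqP; rewrite subr_eq0 => /eqP ->; rewrite mulrC.
have : 0 < sin (x - k%:~R * pi).
  apply: sin_gt0_pi; rewrite lt_def y_ne0 subr_ge0 fl /=.
  by rewrite ltrBlDr -[X in X + _]mul1r -mulrDl addrC.
by rewrite sy ltxx.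
Qed.

Lemma norm_sin_le (R : realType) (y : R) : 0 <= y -> `|sin y| <= y.
Proof.
move=> y0.
have [|c _] := @MVT_segment R sin cos 0 y y0 (fun x _ => is_derive_sin x).
  by apply: continuous_subspaceT => x; exact: continuous_sin.
rewrite sin0 !subr0 => ->.
by rewrite normrM (ger0_norm y0) ler_piMl// cos_max.
Qed.

(** Generically T = pi/|s|. When s = 0 every T satisfies the last condition, and
    T = |t| works, or T = 1 if t = 0 too. *)
Lemma common_grid (R : realType) (t s : R) (k : int) : t * s = pi * k%:~R ->
  exists T : R, exists m l : int,
    [/\ 0 < T, t = m%:~R * T & s * T = l%:~R * pi].
Proof.
move=> ts; have pi0 := @pi_gt0 R.
have [s0|s_ne0] := eqVneq s 0.
  have [->|t_ne0] := eqVneq t 0.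
    by exists 1, 0, 0; rewrite s0 !mul0r.
  exists `|t|, (sgz t), 0; rewrite normr_gt0 s0 !mul0r; split => //.
  by rewrite -sgrEz -numEsg.
have as_ne0 : `|s| != 0 by rewrite normr_eq0.
have s_ratio : s / `|s| = (sgz s)%:~R by rewrite {1}[s]numEsg sgrEz mulfK.
have sg2 : (sgz s)%:~R * (sgz s)%:~R = 1 :> R.
  rewrite -s_ratio mulf_div -normrM ger0_norm ?divff ?mulf_neq0//.
  by rewrite -expr2 sqr_ge0.
exists (pi / `|s|), (sgz s * k), (sgz s); split.
- by rewrite divr_gt0 ?normr_gt0.
- apply: (mulIf s_ne0); rewrite ts intrM.
  transitivity ((sgz s)%:~R * k%:~R * pi * (s / `|s|)); last by field.
  by rewrite s_ratio; ring: sg2.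
- by rewrite -s_ratio; field.
Qed.

(** * Sufficiency: sin(ts) does not vanish *)

Lemma memLp_of_sin_diff (R : realType) (p t s : R) (f : R -> R) : 1 <= p ->
  sin (t * s) != 0 ->
  memLp p (fun x => f (t + x) - f x) ->
  memLp p (fun x => sin (s * x) * f x) ->
  memLp p f.
Proof.
move=> p1 d0; set h := fun x => f (t + x) - f x.
set g := fun x => sin (s * x) * f x.
move=> lh lg.
have lin_meas (F : R -> R) (a b : R) :
    continuous F -> lebesgue_measurable (fun x => F (a + b * x)).
  move=> cF; apply: continuous_lebesgue_measurable => x.
  apply: (@continuous_comp _ _ _ (fun x => a + b * x) F); last exact: cF.
  by apply: cvgD; [exact: cvg_cst|exact: mulrl_continuous].
have msin := lin_meas _ (s * t) s (@continuous_sin R).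
have mcos := lin_meas _ 0 s (@continuous_cos R).
have mcost := lin_meas _ (s * t) s (@continuous_cos R).
have l1 := memLp_bounded_mul p1 mcos (fun x => cos_max _)
  (memLp_translate p1 t lg).
have l2 := memLp_bounded_mul p1 mcos (fun x => cos_max _)
  (memLp_bounded_mul p1 msin (fun x => sin_max _) lh).
have l3 := memLp_bounded_mul p1 mcost (fun x => cos_max _) lg.
have mcst : lebesgue_measurable (fun _ : R => (sin (t * s))^-1).
  by apply: continuous_lebesgue_measurable => x; exact: cvg_cst.
have := memLp_bounded_mul p1 mcst (fun x => lexx _)
  (memLpB p1 (memLpB p1 l1 l2) l3).
congr memLp; apply/funext => x; rewrite /g /h add0r.
apply: (mulfI d0); rewrite mulVKf//.
rewrite mulrDr [in LHS]addrC.
have -> : sin (t * s) = sin ((s * t + s * x) - s * x) by rewrite addrK mulrC.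
by rewrite sinB; ring.
Qed.

(** * Necessity: the harmonic comb *)

Section comb.
Variables (R : realType) (T : R).
Hypothesis T0 : 0 < T.
Local Notation LR := (lebesgue_line R).
Local Notation mu := (@completed_lebesgue_measure R).

Definition tooth_width (j : nat) : R := T / j.+1%:R.

Definition tooth (j : nat) : set R :=
  `[j%:R * T, j%:R * T + tooth_width j[%classic.

Definition comb : set R := \bigcup_j tooth j.

Lemma tooth_width_gt0 j : 0 < tooth_width j.
Proof. by rewrite divr_gt0. Qed.

Lemma tooth_width_le j : tooth_width j <= T.
Proof. by rewrite ler_pdivrMr// ler_peMr ?ler1n// ltW. Qed.

Lemma tooth_widthS j : tooth_width j.+1 <= tooth_width j.
Proof. by rewrite ler_pM2l// lef_pV2 ?posrE// ler_nat. Qed.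

(** The j-th tooth lies in the grid cell [jT, (j+1)T[. *)
Lemma trivIset_tooth : trivIset setT tooth.
Proof.
have tooth_le i j x : tooth i x -> tooth j x -> (i <= j)%N.
  rewrite /tooth /= !in_itv/= => /andP[ix _] /andP[_ xj].
  rewrite -ltnS -(ltr_nat R) -(ltr_pM2r T0) (le_lt_trans ix)//.
  rewrite (lt_le_trans xj)//.
  by rewrite -[j.+1]addn1 natrD mulrDl mul1r lerD2l tooth_width_le.
move=> i j _ _ [x [ix jx]]; apply/eqP; rewrite eqn_leq.
by rewrite (tooth_le _ _ _ ix jx) (tooth_le _ _ _ jx ix).
Qed.

Lemma lebesgue_measurable_itvco (a b : R) :
  measurable (`[a, b[%classic : set LR).
Proof. by apply: sub_caratheodory; exact: measurable_itv. Qed.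

Lemma mu_itvco (a b : R) : a <= b -> mu `[a, b[%classic = (b - a)%:E.
Proof.
(* Both measures are restrictions of the same outer measure. *)
move=> ab; have -> : mu `[a, b[%classic = lebesgue_measure `[a, b[%classic by [].
rewrite lebesgue_measure_itv/= lte_fin.
by move: ab; rewrite le_eqVlt => /predU1P[->|->//]; rewrite ltxx subrr.
Qed.

Lemma mu_tooth j : mu (tooth j) = (tooth_width j)%:E.
Proof.
rewrite mu_itvco; last by rewrite lerDl ltW// tooth_width_gt0.
by rewrite addrAC subrr add0r.
Qed.

Lemma measurable_comb : measurable (comb : set LR).
Proof. by apply: bigcupT_measurable => j; exact: lebesgue_measurable_itvco. Qed.

Lemma measurable_indic_comb : lebesgue_measurable (\1_comb : R -> R).
Proof. exact: (@measurable_indic _ LR R setT comb measurable_comb). Qed.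

Lemma sum_tooth_width_unbounded (M : R) :
  ~ (forall n, \sum_(0 <= j < n) tooth_width j <= M).
Proof.
move=> sM; apply: (@dvg_harmonic R); apply: nondecreasing_is_cvgn.
  apply/nondecreasing_seqP => n; rewrite /series /= big_nat_recr//= lerDl.
  by rewrite invr_ge0.
exists (M / T) => _ [n _ <-]; rewrite ler_pdivlMr// /series /= big_distrl/=.
apply: le_trans (sM n); apply: ler_sum => j _.
by rewrite /tooth_width mulrC.
Qed.

Variable p : R.
Hypothesis p1 : 1 <= p.

Lemma indic_comb_notin_Lp : ~ memLp p (\1_comb : R -> R).
Proof.
move=> /(@Lfun_integralP _ LR R mu p p1)[_].
have -> : (\int[mu]_x (`|\1_comb x : R| `^ p)%:E = \int[mu]_x (\1_comb x)%:E)%E.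
  apply: eq_integral => x _; rewrite indicE; case: (_ \in _).
    by rewrite normr1 powR1.
  by rewrite normr0 powR0// gt_eqF// (lt_le_trans _ p1).
rewrite (@integral_indic _ LR R mu setT measurableT comb measurable_comb) setIT.
move=> fin.
have /fineK muE : mu comb \is a fin_num by rewrite ge0_fin_numE.
apply: (@sum_tooth_width_unbounded (fine (mu comb))) => n.
rewrite -lee_fin muE /comb.
rewrite (measure_bigcup mu setT tooth) //; last 2 first.
- by move=> i _; exact: lebesgue_measurable_itvco.
- exact: trivIset_tooth.
rewrite -sumEFin.
under eq_bigr do rewrite -mu_tooth.
have -> : (\sum_(i <oo | i \in setT) mu (tooth i) =
           \sum_(i <oo) mu (tooth i))%E.
  by apply: eq_eseriesl => i; rewrite in_setT.
exact: nneseries_lim_ge.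
Qed.

(** Translating by T puts tooth i+1 on top of tooth i, which is wider: they
    differ by an interval of length w_i - w_(i+1). Tooth 0 is sent to the
    left of the origin, where it meets no other tooth. *)
Lemma comb_step_memLp :
  memLp p (fun x => (\1_comb (T + x) : R) - \1_comb x).
Proof.
pose w := tooth_width.
pose A j : set R := if j is i.+1
  then `[i%:R * T + w i.+1, i%:R * T + w i[%classic
  else `[- T, - T + w 0%N[%classic.
have muA0 : mu (A 0%N) = (w 0%N)%:E.
  rewrite mu_itvco; last by rewrite lerDl ltW// tooth_width_gt0.
  by rewrite addrAC subrr add0r.
have muAS i : mu (A i.+1) = (w i - w i.+1)%:E.
  rewrite mu_itvco; last by rewrite lerD2l tooth_widthS.
  by rewrite opprD addrACA subrr add0r.
apply: (@Lfun_of_cover _ LR R mu p p1 (w 0%N + w 0%N) _ (fun=> 1) A).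
- apply: lebesgue_measurableB; last exact: measurable_indic_comb.
  exact: (lebesgue_measurable_translate T measurable_indic_comb).
- by move=> x; rewrite !indicE; case: (_ \in _); case: (_ \in _);
    rewrite ?subrr ?subr0 ?sub0r ?normrN ?normr0 ?normr1.
- by [].
- by case=> [|i]; exact: lebesgue_measurable_itvco.
- move=> x; rewrite !indicE.
  have [|Tx] := boolP (T + x \in comb); have [|x0] := boolP (x \in comb).
  + by rewrite subrr eqxx.
  + rewrite inE => -[[|i] _]; rewrite /tooth /= in_itv/= => /andP[jx xj] _.
      exists 0%N; last by rewrite subr0 normr1.
      by rewrite /A /= in_itv/= /w; move: jx xj; lra.
    (* A translated tooth i+1 is covered by tooth i. *)
    exfalso; move/negP: x0; apply; rewrite inE; exists i => //.
    rewrite /tooth /= in_itv/=; have := tooth_widthS i.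
    by move: jx xj; rewrite -addn1 natrD mulrDl mul1r; lra.
  + rewrite inE => -[i _]; rewrite /tooth /= in_itv/= => /andP[ix xi] _.
    exists i.+1; last by rewrite sub0r normrN normr1.
    rewrite /A /= in_itv/= xi andbT leNgt; apply/negP => xlt.
    move/negP: Tx; apply; rewrite inE; exists i.+1 => //.
    rewrite /tooth /= in_itv/= -[i.+1%:R]/((1 + i)%:R) natrD mulrDl mul1r.
    by move: ix xlt; rewrite /w; lra.
  + by rewrite subrr eqxx.
- have sumE n : (\sum_(0 <= j < n.+1) 1%:E * mu (A j) =
      (w 0%N + w 0%N - w n)%:E)%E.
    elim: n => [|n IH]; first by rewrite big_nat1 mul1e muA0 addrK.
    by rewrite big_nat_recr//= IH mul1e muAS -EFinD; congr EFin; lra.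
  case=> [|n]; first by rewrite big_nil lee_fin addr_ge0// ltW// tooth_width_gt0.
  by rewrite sumE lee_fin lerBlDr lerDl ltW// tooth_width_gt0.
Qed.

Lemma comb_shift_memLp (m : int) :
  memLp p (fun x => (\1_comb (m%:~R * T + x) : R) - \1_comb x).
Proof.
have shift_nat (n : nat) :
    memLp p (fun x => (\1_comb (n%:R * T + x) : R) - \1_comb x).
  elim: n => [|n IH].
    have -> : (fun x => \1_comb (0%:R * T + x) - \1_comb x) = (fun=> 0 : R).
      by apply/funext => x; rewrite mul0r add0r subrr.
    exact: memLp0.
  have := memLpD p1 (memLp_translate p1 (n%:R * T) comb_step_memLp) IH.
  congr memLp; apply/funext => x /=.
  rewrite addrA subrK; congr (\1_comb _ - _).
  by rewrite addrA -[n.+1]add1n natrD mulrDl mul1r.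
case: m => n; first exact: shift_nat.
(* f(x - c) - f(x) is the opposite of f(c + .) - f at x - c. *)
have := memLpN (memLp_translate p1 (- (n.+1%:R * T)) (shift_nat n.+1)).
congr memLp; apply/funext => x /=.
by rewrite opprB addrA subrr add0r NegzE mulrNz mulNr.
Qed.

Lemma sin_comb_memLp (s : R) (l : int) : s * T = l%:~R * pi ->
  memLp p (fun x => sin (s * x) * \1_comb x).
Proof.
move=> sT; pose w := tooth_width.
apply: (@Lfun_of_cover _ LR R mu p p1 (`|s| * (2 * T * w 0%N)) _
          (fun j => `|s| * w j) tooth).
- apply: lebesgue_measurableM; last exact: measurable_indic_comb.
  apply: continuous_lebesgue_measurable => x.
  apply: (@continuous_comp _ _ _ (fun x => s * x) sin).
    exact: mulrl_continuous.
  exact: continuous_sin.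
- move=> x; rewrite normrM indicE mulr_ile1 ?normr_ge0 ?sin_max//.
  by case: (_ \in _); rewrite ?normr0 ?normr1.
- by move=> j; rewrite mulr_ge0// ltW// tooth_width_gt0.
- by move=> j; exact: lebesgue_measurable_itvco.
- move=> x; rewrite indicE; have [|] := boolP (x \in comb); last first.
    by rewrite mulr0 eqxx.
  rewrite inE => -[j _ xj] _; exists j => //; rewrite mulr1.
  move: xj; rewrite /tooth /= in_itv/= => /andP[jx xj].
  have sinE (y : R) : `|sin y| = `|sin `|y| |.
    by case: (ger0P y) => _ //; rewrite sinN normrN.
  have -> : s * x = s * (x - j%:R * T) + (j%:Z * l)%:~R * pi.
    by rewrite intrM -mulrA -sT -pmulrn; ring.
  rewrite norm_sin_add_pi sinE (le_trans (norm_sin_le (normr_ge0 _)))//.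
  rewrite normrM ler_wpM2l// ger0_norm ?subr_ge0//.
  by rewrite lerBlDl ltW.
- (* Telescoping: 1/(j+1)^2 <= 2/((j+1)(j+2)). *)
  have wsq j : w j ^+ 2 <= 2 * T * (w j - w j.+1).
    rewrite /w /tooth_width -[j.+2]addn1 natrD.
    have a1 : 1 <= j.+1%:R :> R by rewrite ler1n.
    move: (j.+1%:R : R) a1 => a a1.
    have a_ne0 : a != 0 by apply: lt0r_neq0; lra.
    have aS_ne0 : a + 1 != 0 by apply: lt0r_neq0; lra.
    rewrite -subr_ge0.
    have -> : 2 * T * (T / a - T / (a + 1)) - (T / a) ^+ 2 =
              T ^+ 2 * (a - 1) / (a ^+ 2 * (a + 1)).
      by field; rewrite a_ne0 aS_ne0.
    apply: divr_ge0; first by rewrite mulr_ge0 ?sqr_ge0// subr_ge0.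
    by rewrite mulr_ge0 ?sqr_ge0//; lra.
  have sumE n : \sum_(0 <= j < n) w j ^+ 2 <= 2 * T * (w 0%N - w n).
    elim: n => [|n IH]; first by rewrite big_nil subrr mulr0.
    rewrite big_nat_recr//= (le_trans (lerD IH (wsq n)))// -mulrDr.
    by rewrite addrA subrK.
  move=> n; rewrite (eq_bigr (fun j => (`|s| * w j ^+ 2)%:E)); last first.
    by move=> j _; rewrite [X in (_ * X)%E]mu_tooth -EFinM -mulrA.
  rewrite sumEFin lee_fin -big_distrr/= ler_wpM2l//.
  rewrite (le_trans (sumE n))// ler_wpM2l//; first by rewrite mulr_ge0// ltW.
  by rewrite gerBl ltW// tooth_width_gt0.
Qed.

End comb.

(** * The equivalence *)

Lemma memLp_of_sin_diff_iff (R : realType) (p t s : R) : 1 <= p ->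
  (forall f : R -> R, lebesgue_measurable f ->
      memLp p (fun x => f (t + x) - f x) ->
      memLp p (fun x => sin (s * x) * f x) ->
      memLp p f)
    <-> ~ ([set pi * k%:~R | k in [set: int]] (t * s)).
Proof.
move=> p1; split=> [A [k _ /esym/common_grid[T [m [l [T0 tm sT]]]]]|B f _].
  apply: (indic_comb_notin_Lp T0 p1); apply: A.
  - exact: measurable_indic_comb.
  - by rewrite tm; exact: comb_shift_memLp.
  - exact: sin_comb_memLp sT.
apply: memLp_of_sin_diff p1 _; apply/eqP => /sin_eq0_pi [k tsk].
by apply: B; exists k.
Qed.

Theorem proposition5 (R : realType) (p : R) (hp : 1 <= p) (t s : R) :
  ((forall f : R -> R, lebesgue_measurable f ->
      memLp p (fun x => f (t + x) - f x) ->
      memLp p (fun x => sin (s * x) * f x) ->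
      memLp p f)
    <-> ~ ([set pi * k%:~R | k in [set: int]] (t * s)))
  /\
  ((forall f : R -> R[i], lebesgue_measurableC f ->
      memLpC p (fun x => f (t + x) - f x) ->
      memLpC p (fun x => (sin (s * x))%:C%C * f x) ->
      memLpC p f)
    <-> ~ ([set pi * k%:~R | k in [set: int]] (t * s))).
Proof.
have real_iff := memLp_of_sin_diff_iff t s hp.
split; first exact: real_iff.
(* The complex statement (A) is equivalent to the real one: a real function is
   a complex one, and a complex function is treated componentwise. *)
apply: iff_trans real_iff.
have ReB (z w : R[i]) : complex.Re (z - w) = complex.Re z - complex.Re w.
  by case: z w => [? ?] [].
have ImB (z w : R[i]) : complex.Im (z - w) = complex.Im z - complex.Im w.
  by case: z w => [? ?] [].
have ReM (a : R) (z : R[i]) : complex.Re (a%:C%C * z) = a * complex.Re z.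
  by case: z => b c /=; rewrite mul0r subr0.
have ImM (a : R) (z : R[i]) : complex.Im (a%:C%C * z) = a * complex.Im z.
  by case: z => b c /=; rewrite mul0r addr0.
split=> A f mf.
  move=> df sf.
  suff /(memLpC_components hp)[] : memLpC p (fun x => (f x)%:C%C) by [].
  have m0 : lebesgue_measurable (fun _ : R => 0).
    by apply: continuous_lebesgue_measurable => x; exact: cvg_cst.
  apply: A; first by split.
  - apply/(memLpC_components hp); split => /=; first exact: df.
    under [X in memLp _ X]funext do rewrite subr0.
    exact: memLp0.
  - apply/(memLpC_components hp); split => /=.
      by under [X in memLp _ X]funext do rewrite mul0r subr0.
    under [X in memLp _ X]funext do rewrite mul0r mulr0 addr0.
    exact: memLp0.
case: mf => mr mi /(memLpC_components hp)[dr di] /(memLpC_components hp)[sr si].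
apply/(memLpC_components hp); split; apply: A => //.
- by move: dr; congr memLp; apply/funext => x; rewrite ReB.
- by move: sr; congr memLp; apply/funext => x; rewrite ReM.
- by move: di; congr memLp; apply/funext => x; rewrite ImB.
- by move: si; congr memLp; apply/funext => x; rewrite ImM.
Qed.
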